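(* Let $Y$ be a real vector space, $k\in Y\setminus\{0\}$, and assume that $A\subset Y$ is a non-trivial convex cone. Then: (a) $\operatorname{dom}\varphi_{A,k}$ is convex. (b) $\varphi_{A,k}$ is sublinear and $(-A)$-monotone. Moreover, $\varphi_{A,k}$ is strictly $(-\operatorname{core}A)$-monotone on each set $F\subseteq Y$ on which it is finite-valued. (c) If $k\in A$, then $\varphi_{A,k}(y)=-\infty$ for all $y\in\operatorname{dom}\varphi_{A,k}$. If $k\in(-A)\cap A$, then $\operatorname{dom}\varphi_{A,k}=A$. (d) If $k\in-A$, then $\operatorname{dom}\varphi_{A,k}=A+\mathbb{R}_>k$. If, additionally, $A$ is $k$-directionally closed, then $\{y\in Y\mid\varphi_{A,k}(y)\le t\}=A+tk$ for all $t\in\mathbb{R}$. (e) $\varphi_{A,k}$ is finite-valued (on all of $Y$) if and only if (i) $k\in-\operatorname{core}A$, or (ii) $A$ is a linear subspace of $Y$ of codimension $1$ and $k\notin A$. For $k\in-\operatorname{core}A$, we have $\{y\in Y\mid\varphi_{A,k}(y)<t\}=\operatorname{core}A+tk$ for all $t\in\mathbb{R}$. In case (ii), $\varphi_{A,k}$ is a linear function.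
   Context: Let $\nu$ be a symbol not in $\overline{\mathbb{R}}=\mathbb{R}\cup\{-\infty,+\infty\}$, not comparable with real numbers; $\inf\emptyset:=\nu$. For nonempty $A\subseteq Y$, $k\in Y\setminus\{0\}$, $\varphi_{A,k}:Y\to\overline{\mathbb{R}}\cup\{\nu\}$ is $\varphi_{A,k}(y):=\inf\{t\in\mathbb{R}\mid y\in A+tk\}$ ($-\infty$ if unbounded below); $\operatorname{dom}\varphi_{A,k}=\{y\in Y\mid\varphi_{A,k}(y)\in\mathbb{R}\cup\{-\infty\}\}$; finite-valued on $F$ means $\varphi_{A,k}(y)\in\mathbb{R}$ for all $y\in F$. A set $C$ is a cone iff $\lambda c\in C$ for all $\lambda\in[0,\infty)$, $c\in C$; a cone $C\subseteq Y$ is non-trivial iff $C\ne\emptyset$, $C\ne\{0\}$, $C\ne Y$. $\varphi_{A,k}$ is sublinear iff it is convex and positively homogeneous, i.e. iff its epigraph $\{(y,t)\in Y\times\mathbb{R}\mid\varphi_{A,k}(y)\le t\}$ is a convex cone. For $B\subseteq Y$ and $F\subseteq\operatorname{dom}\varphi$, $\varphi$ is $B$-monotone on $F$ iff $y^1,y^2\in F$, $y^2-y^1\in B$ imply $\varphi(y^1)\le\varphi(y^2)$; strictly $B$-monotone on $F$ iff $y^1,y^2\in F$, $y^2-y^1\in B\setminus\{0\}$ imply $\varphi(y^1)<\varphi(y^2)$; $B$-monotone without mention of a set means on $\operatorname{dom}\varphi$. $\mathbb{R}_>=(0,\infty)$. $\operatorname{core}A$ is the algebraic interior: $a\in\operatorname{core}A$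 iff $a\in A$ and for each $v\in Y$ there is $\varepsilon>0$ with $a+sv\in A$ for all $s\in[0,\varepsilon]$. $A$ is $k$-directionally closed if for every $y\in Y$: whenever there is a sequence $(t_n)$ of positive reals decreasing to $0$ with $y-t_nk\in A$ for all $n$, then $y\in A$. *)

(* Defs.v *)
From mathcomp Require Import all_boot all_order all_algebra.
From mathcomp Require Import all_classical all_reals all_analysis.

Set Implicit Arguments.
Unset Strict Implicit.
Unset Printing Implicit Defensive.

Import Order.TTheory GRing.Theory Num.Theory.
Import numFieldNormedType.Exports.

Local Open Scope classical_set_scope.
Local Open Scope ring_scope.

(* The value set \bar R together with the extra symbol nu, encoded by [None].
   The symbol nu is comparable with nothing: any comparison involving it is
   [False]. *)
Definition nu_ereal (R : realType) := option (\bar R).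

Definition nu_le (R : realType) (u v : nu_ereal R) : Prop :=
  if (u, v) is (Some a, Some b) then (a <= b)%E else False.

Definition nu_lt (R : realType) (u v : nu_ereal R) : Prop :=
  if (u, v) is (Some a, Some b) then (a < b)%E else False.

Definition nu_inf (R : realType) (S : set R) : nu_ereal R :=
  if `[< S = set0 >] then None else Some (ereal_inf (EFin @` S)).

Section sets.
Context {R : realType} {Y : lmodType R}.
Implicit Types (A : set Y) (k y : Y).

Definition translate A y : set Y := [set a + y | a in A].

Definition oppset A : set Y := [set - a | a in A].

Definition is_cone A : Prop :=
  forall (l : R) (c : Y), 0 <= l -> A c -> A (l *: c).

Definition nontrivial_convex_cone A : Prop :=
  [/\ is_cone A, convex_set (M := Y) A,
      A <> set0, A <> [set 0] & A <> [set: Y]].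

Definition core A : set Y :=
  [set a | A a /\ forall v : Y, exists2 e : R, 0 < e &
     forall s : R, 0 <= s <= e -> A (a + s *: v)].

Definition directionally_closed A k : Prop :=
  forall y, (exists t : nat -> R,
      [/\ forall n, 0 < t n, decreasing_seq t, t @ \oo --> 0 &
          forall n, A (y - t n *: k)]) -> A y.

Definition linear_subspace A : Prop := GRing.submod_closed (mem A).

(* For a linear subspace A: the quotient Y / A has dimension n, i.e. the
   classes modulo A of some e_0, ..., e_(n-1) form a basis of Y / A. *)
Definition has_codim A (n : nat) : Prop :=
  exists e : 'I_n -> Y,
    (forall c : 'I_n -> R, A (\sum_(i < n) c i *: e i) -> forall i, c i = 0) /\
    (forall y, exists c : 'I_n -> R, A (y - \sum_(i < n) c i *: e i)).

End sets.

Section functions.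
Context {R : realType} {Y : lmodType R}.
Implicit Types (phi : Y -> nu_ereal R) (B F : set Y).

(* The values of a point of the domain are real or -oo. *)
Definition nu_dom phi : set Y :=
  [set y | exists2 x : \bar R, phi y = Some x & x != +oo%E].

Definition finite_valued phi F : Prop :=
  forall y, F y -> exists r : R, phi y = Some r%:E.

Definition epigraph phi : set (Y * R^o)%type :=
  [set p | nu_le (phi p.1) (Some (p.2 : R)%:E)].

Definition sublinear phi : Prop :=
  convex_set (M := (Y * R^o)%type) (epigraph phi) /\ is_cone (epigraph phi).

(* The two monotonicity notions are meant for F included in [nu_dom phi]. *)
Definition monotone_on phi B F : Prop :=
  forall y1 y2, F y1 -> F y2 -> B (y2 - y1) -> nu_le (phi y1) (phi y2).

Definition strictly_monotone_on phi B F : Prop :=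
  forall y1 y2, F y1 -> F y2 -> (B `\ 0) (y2 - y1) -> nu_lt (phi y1) (phi y2).

Definition monotone_dom phi B : Prop := monotone_on phi B (nu_dom phi).

Definition is_linear_function phi : Prop :=
  exists f : {scalar Y}, forall y, phi y = Some (f y)%:E.

End functions.

Definition phi_ (R : realType) (Y : lmodType R) (A : set Y) (k : Y)
    (y : Y) : nu_ereal R :=
  nu_inf [set t : R | translate A (t *: k) y].

(* Main.v *)
Require Import Defs.
From HB Require Import structures.
From mathcomp Require Import all_boot all_order all_algebra.
From mathcomp Require Import all_classical all_reals all_analysis.
From mathcomp Require Import lra.

Set Implicit Arguments.
Unset Strict Implicit.
Unset Printing Implicit Defensive.

Import Order.TTheory GRing.Theory Num.Theory.
Import numFieldNormedType.Exports.

Local Open Scope classical_set_scope.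
Local Open Scope ring_scope.

(** For a fixed [y], everything is read off the set of parameters
    T(y) = [{t | A (y - t *: k)}], whose infimum is [phi_ A k y]: the point
    [y] is in the domain iff T(y) is nonempty, the value is below [t] iff some
    parameter is ([phi_ltP]), and it is at most [t] iff there are parameters
    below every [s > t] ([phi_leP]).

    A convex cone is a nonempty set closed under addition and nonnegative
    scaling ([convex_cone_add], [convex_cone_convex]).  Hence T(x) + T(y) is
    contained in T(x + y) and l T(y) in T(l y), which makes the domain and the
    epigraph convex cones; moreover T grows when an element of [A] is added to
    the point, which is monotonicity.  Adding an element of [core A] even
    allows one to lower the parameter by some e > 0, whence strict monotonicity.
    The direction [k] governs the shape of T(y): downward closed, hence of
    infimum -oo, when [k] is in [A], and upward closed when [- k] is.

    Finite values everywhere exclude [A k].  If [A (- k)], then every T(v)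
    contains a positive t, and [v - t *: k] in [A] rescales to
    [- k + t^-1 *: v] in [A], that is, [- k] is in the core ([finite_core]).
    If [A (- k)] fails too, then [A] meets the line of [k] only in 0; since
    every T(- a) is nonempty, [A] is closed under opposites, and [k] spans a
    complement ([finite_hyperplane]).  Conversely, if [- k] is in the core,
    each T(y) is nonempty, and it is bounded below because a very negative
    parameter would put [k] into [A], hence 0 into the core of [A], forcing
    [A] to be all of [Y] ([core_finite], [core_opp]).  For a hyperplane not
    containing [k], T(y) consists of the single coordinate of [y] along [k],
    a linear function of [y] ([hyperplane_linear]). *)

(** * Convex cones and their cores *)

Section cones.
Context {R : realType} {Y : lmodType R}.
Implicit Types (A : set Y) (a b v : Y).

Lemma translateP A y x : translate A y x <-> A (x - y).
Proof.
split=> [[a Aa <-]|Axy]; first by rewrite addrK.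
by exists (x - y) => //; rewrite subrK.
Qed.

Lemma oppsetP A y : oppset A y <-> A (- y).
Proof.
split=> [[a Aa <-]|Ay]; first by rewrite opprK.
by exists (- y) => //; rewrite opprK.
Qed.

(** The sum is twice the midpoint. *)
Lemma convex_cone_add A : is_cone A -> convex_set (M := Y) A ->
  forall a b, A a -> A b -> A (a + b).
Proof.
move=> cA cvA a b Aa Ab.
have h0 : 0 <= (2^-1 : R) by lra.
have h1 : (2^-1 : R) <= 1 by lra.
have : (a : convex_lmodType Y) \in A by rewrite inE.
have : (b : convex_lmodType Y) \in A by rewrite inE.
move=> Ab' Aa'; have := cvA _ _ (Itv01 h0 h1) Aa' Ab'.
rewrite inE /conv/= => /(cA 2 _ (ler0n R 2)).
rewrite scalerDr !scalerA /unstable.onem.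
have -> : (2 * 2^-1 : R) = 1 by lra.
have -> : (2 * (1 - 2^-1) : R) = 1 by lra.
by rewrite !scale1r.
Qed.

Lemma convex_cone_convex A : is_cone A ->
  (forall a b, A a -> A b -> A (a + b)) -> convex_set (M := Y) A.
Proof.
move=> cA AD a b l; rewrite !inE => Aa Ab.
apply: AD; apply: cA => //.
exact: unstable.onem_ge0.
Qed.

Lemma cone_inv A a (l : R) : is_cone A -> 0 < l -> A (l *: a) -> A a.
Proof.
move=> cA l0 /(cA l^-1); rewrite invr_ge0 (ltW l0) => /(_ isT).
by rewrite scalerA mulVf ?scale1r// gt_eqF.
Qed.

Lemma cone0 A : nontrivial_convex_cone A -> A 0.
Proof.
case=> cA _ /eqP/set0P[a Aa] _ _.
by rewrite -(scale0r a); exact: cA.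
Qed.

Lemma coneD A a b : nontrivial_convex_cone A -> A a -> A b -> A (a + b).
Proof. by case=> cA cvA _ _ _; exact: convex_cone_add. Qed.

Lemma coneZ A a (l : R) : nontrivial_convex_cone A -> 0 <= l -> A a -> A (l *: a).
Proof. by case=> cA _ _ _ _; exact: cA. Qed.

Lemma core_dir A a v : core A a -> exists2 e : R, 0 < e & A (a + e *: v).
Proof.
move=> [_ /(_ v)[e e0 h]]; exists e => //.
by apply: h; rewrite lexx (ltW e0).
Qed.

Lemma coreD A a b : nontrivial_convex_cone A -> core A a -> A b -> core A (a + b).
Proof.
move=> hA [Aa ca] Ab; split; first exact: coneD.
move=> v; have [e e0 h] := ca v; exists e => // s se.
by rewrite addrAC; apply: coneD => //; exact: h.
Qed.

Lemma coreZ A a (l : R) : nontrivial_convex_cone A -> 0 < l -> core A a ->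
  core A (l *: a).
Proof.
move=> hA l0 [Aa ca]; split; first exact: coneZ (ltW l0) Aa.
move=> v; have [e e0 h] := ca (l^-1 *: v); exists e => // s /h.
move/(coneZ hA (ltW l0)).
by rewrite scalerDr !scalerA mulrAC mulfV ?mul1r// gt_eqF.
Qed.

(** If [a] were in [A], then from [- a + e *: v] in [A] one would get
    [e *: v] in [A] for every [v], so [A] would be everything. *)
Lemma core_opp A a : nontrivial_convex_cone A -> core A (- a) -> ~ A a.
Proof.
move=> hA ca Aa; case: (hA) => cA _ _ _; apply; apply/seteqP; split=> // v _.
have [e e0 /(coneD hA Aa)] := core_dir v ca.
by rewrite addrA subrr add0r; exact: cone_inv.
Qed.

End cones.

(** * The values of the functional *)

Section values.
Context {R : realType} {Y : lmodType R}.
Variables (A : set Y) (k : Y).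
Implicit Types (x y : Y) (r s t u : R).

Lemma phi_param y :
  [set t : R | translate A (t *: k) y] = [set t | A (y - t *: k)].
Proof. by apply/seteqP; split=> t /translateP. Qed.

Lemma phi_some y t : A (y - t *: k) ->
  phi_ A k y = Some (ereal_inf (EFin @` [set t | A (y - t *: k)])).
Proof.
move=> At; rewrite /phi_ /nu_inf phi_param; case: asboolP => // h.
by have : [set t | A (y - t *: k)] t by []; rewrite h.
Qed.

Lemma phi_none y : (forall t, ~ A (y - t *: k)) -> phi_ A k y = None.
Proof.
move=> h; rewrite /phi_ /nu_inf phi_param; case: asboolP => // -[].
by apply/seteqP; split=> t //= /h.
Qed.

Lemma phi_ltP y t :
  nu_lt (phi_ A k y) (Some t%:E) <-> exists2 u, u < t & A (y - u *: k).
Proof.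
have [[v Av]|/forallNP h] := pselect (exists t, A (y - t *: k)); last first.
  by rewrite (phi_none h); split=> // -[u _ /h].
rewrite (phi_some Av) /=; split=> [/ereal_inf_lt[_ [u Au <-]]|[u ut Au]].
  by rewrite lte_fin => ut; exists u.
apply: (@le_lt_trans _ _ u%:E); last by rewrite lte_fin.
by apply: ereal_inf_lbound; exists u.
Qed.

Lemma phi_leP y t : nu_le (phi_ A k y) (Some t%:E) <->
  forall s, t < s -> exists2 u, u < s & A (y - u *: k).
Proof.
split=> [h s ts|h].
  apply/phi_ltP; case: (phi_ A k y) h => //= a at_.
  by apply: le_lt_trans at_ _; rewrite lte_fin.
have [|u _ Au] := h (t + 1); first by rewrite ltrDl.
rewrite (phi_some Au) /=; apply/lee_addgt0Pr => e e0.
have [|v ve Av] := h (t + e); first by rewrite ltrDl.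
apply: (@le_trans _ _ v%:E); last by rewrite lee_fin ltW.
by apply: ereal_inf_lbound; exists v.
Qed.

Lemma phi_le y t : A (y - t *: k) -> nu_le (phi_ A k y) (Some t%:E).
Proof. by move=> At; apply/phi_leP => s ts; exists t. Qed.

Lemma phi_domP y : nu_dom (phi_ A k) y <-> exists t, A (y - t *: k).
Proof.
split=> [[x hx _]|[t At]].
  by apply: contrapT => /forallNP /phi_none; rewrite hx.
have := phi_le At; rewrite (phi_some At) /= => le_t.
eexists; first exact: phi_some At.
by apply/eqP => inf_pinfty; rewrite inf_pinfty in le_t.
Qed.

Lemma phi_Ny y : (forall t, nu_lt (phi_ A k y) (Some t%:E)) ->
  phi_ A k y = Some -oo%E.
Proof.
case: (phi_ A k y) => [[r| |]|] h.
- by have : (r%:E < r%:E)%E := h r; rewrite ltxx.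
- by have : (+oo < 0%:E)%E := h 0; rewrite ltNge leey.
- by [].
- by have := h 0.
Qed.

Lemma phi_bounded_real y t m : A (y - t *: k) ->
  (forall u, A (y - u *: k) -> m <= u) -> exists r, phi_ A k y = Some r%:E.
Proof.
move=> At hm; have := phi_le At.
have : ~ nu_lt (phi_ A k y) (Some m%:E).
  by move/phi_ltP => [u um /hm]; rewrite leNgt um.
rewrite (phi_some At); case: (ereal_inf _) => [r| |]; first by exists r.
- by [].
- by case; exact: ltNyr.
Qed.

End values.

(** * The functional of a convex cone *)

Section cone_functional.
Context {R : realType} {Y : lmodType R}.
Variables (A : set Y) (k : Y).
Hypothesis hA : nontrivial_convex_cone A.
Implicit Types (x y : Y) (r s t u : R).

Lemma param_add x y s t : A (x - s *: k) -> A (y - t *: k) ->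
  A ((x + y) - (s + t) *: k).
Proof.
by move=> Ax Ay; rewrite scalerDl opprD addrACA; exact: coneD.
Qed.

Lemma param_scale y t l : 0 <= l -> A (y - t *: k) -> A (l *: y - (l * t) *: k).
Proof. by move=> l0 Ay; rewrite -scalerA -scalerBr; exact: coneZ. Qed.

Lemma param_down y s t : A k -> s <= t -> A (y - t *: k) -> A (y - s *: k).
Proof.
move=> Ak st Ay.
have -> : y - s *: k = (y - t *: k) + (t - s) *: k.
  by rewrite scalerBl addrA subrK.
by apply: coneD => //; apply: coneZ => //; rewrite subr_ge0.
Qed.

Lemma param_up y s t : A (- k) -> s <= t -> A (y - s *: k) -> A (y - t *: k).
Proof.
move=> Ak st Ay.
have -> : y - t *: k = (y - s *: k) + (t - s) *: (- k).
  by rewrite scalerN scalerBl opprB addrA subrK.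
by apply: coneD => //; apply: coneZ => //; rewrite subr_ge0.
Qed.

Lemma phi_dom_convex : convex_set (M := Y) (nu_dom (phi_ A k)).
Proof.
apply: convex_cone_convex => [l y l0 /phi_domP[t At]|x y /phi_domP[s As] /phi_domP[t At]].
  by apply/phi_domP; exists (l * t); exact: param_scale.
by apply/phi_domP; exists (s + t); exact: param_add.
Qed.

(** Given [s > a + b], the slack [s - (a + b)] is split equally between the two
    arguments, since the infima need not be attained. *)
Lemma phi_epigraph_add (p q : Y * R^o) : epigraph (phi_ A k) p ->
  epigraph (phi_ A k) q -> epigraph (phi_ A k) (p + q).
Proof.
case: p q => [x a] [y b] /phi_leP /= hx /phi_leP /= hy.
apply/phi_leP => /= s.
rewrite -[_ + _]/((a : R) + (b : R)) => abs.
have [|u us Au] := hx (a + (s - (a + b)) / 2); first lra.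
have [|v vs Av] := hy (b + (s - (a + b)) / 2); first lra.
by exists (u + v); [lra|exact: param_add].
Qed.

Lemma phi_epigraph_cone : is_cone (epigraph (phi_ A k)).
Proof.
move=> l [y a] l0 /phi_leP /= hy; apply/phi_leP => /= s.
rewrite -[_ *: _]/(l * (a : R)) => las.
have [l0'|l_neq0] := eqVneq l 0.
  (* The zero vector always has the parameter 0, whatever the value at [y]. *)
  rewrite l0' mul0r in las; exists 0 => //.
  by rewrite l0' !scale0r subrr; exact: cone0.
have lp : 0 < l by rewrite lt_neqAle eq_sym l_neq0.
have [|u us Au] := hy (s / l); first by rewrite ltr_pdivlMr// mulrC.
by exists (l * u); [rewrite mulrC -ltr_pdivlMr|exact: param_scale].
Qed.

Lemma phi_sublinear : sublinear (phi_ A k).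
Proof.
split; last exact: phi_epigraph_cone.
apply: convex_cone_convex; first exact: phi_epigraph_cone.
by move=> p q; exact: phi_epigraph_add.
Qed.

Lemma phi_monotone : monotone_dom (phi_ A k) (oppset A).
Proof.
move=> x y _ /phi_domP[t At] /oppsetP; rewrite opprB => Axy.
have sub u : A (y - u *: k) -> A (x - u *: k).
  move=> Au; have -> : x - u *: k = (x - y) + (y - u *: k).
    by rewrite addrA subrK.
  exact: coneD.
rewrite (phi_some (sub _ At)) (phi_some At) /=.
apply: ereal_inf_le_tmp => _ [u Au <-]; by exists u => //; exact: sub.
Qed.

(** The core leaves room to decrease every parameter by a fixed [e > 0]; a
    real value, unlike -oo, is then strictly smaller. *)
Lemma phi_strictly_monotone (F : set Y) : finite_valued (phi_ A k) F ->
  strictly_monotone_on (phi_ A k) (oppset (core A)) F.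
Proof.
move=> finF x y Fx Fy [/oppsetP cxy _]; rewrite opprB in cxy.
have [e e0 Ae] := core_dir k cxy.
have [r hr] := finF _ Fy; rewrite hr; apply/phi_ltP.
have /phi_leP/(_ (r + e)) : nu_le (phi_ A k y) (Some r%:E).
  by rewrite hr; exact: lexx.
rewrite ltrDl => /(_ e0)[u ur Au].
exists (u - e); first lra.
have -> : x - (u - e) *: k = (x - y + e *: k) + (y - u *: k).
  by rewrite scalerBl opprB addrACA subrK addrCA addrA.
exact: coneD.
Qed.

(** The parameters form a nonempty set that is closed downwards. *)
Lemma phi_cone_Ny y : A k -> nu_dom (phi_ A k) y -> phi_ A k y = Some -oo%E.
Proof.
move=> Ak /phi_domP[t At]; apply: phi_Ny => s; apply/phi_ltP.
exists (Num.min t (s - 1)); first by rewrite gt_min; apply/orP; right; lra.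
by apply: param_down At => //; rewrite ge_min lexx.
Qed.

Lemma phi_dom_lineality : A (- k) -> A k -> nu_dom (phi_ A k) = A.
Proof.
move=> ANk Ak; apply/seteqP; split=> y.
  move=> /phi_domP[t At].
  have : A (y - 0 *: k).
    by have [t0|/ltW t0] := leP t 0; [exact: param_up At|exact: param_down At].
  by rewrite scale0r subr0.
by move=> Ay; apply/phi_domP; exists 0; rewrite scale0r subr0.
Qed.

Lemma phi_dom_upward : A (- k) -> nu_dom (phi_ A k) =
  [set a + b | a in A & b in [set t *: k | t in [set t : R | 0 < t]]].
Proof.
move=> ANk; apply/seteqP; split=> y.
  move=> /phi_domP[t At].
  have t1 : 0 < Num.max t 0 + 1 by rewrite ltr_wpDl// le_max lexx orbT.
  exists (y - (Num.max t 0 + 1) *: k).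
    apply: param_up At => //; rewrite -[leLHS]addr0 lerD//.
    by rewrite le_max lexx.
  by exists ((Num.max t 0 + 1) *: k); [exists (Num.max t 0 + 1)|rewrite subrK].
move=> [a Aa [_ [t t0 <-] <-]]; apply/phi_domP; exists t.
by rewrite addrK.
Qed.

(** All [s > t] are parameters, because parameters are closed upwards;
    directional closedness passes to the limit along [t + n.+1^-1]. *)
Lemma phi_sublevel_upward t : A (- k) -> directionally_closed A k ->
  [set y | nu_le (phi_ A k y) (Some t%:E)] = translate A (t *: k).
Proof.
move=> ANk clA; apply/seteqP; split=> y; last first.
  by move=> /translateP; exact: phi_le.
move=> /phi_leP h; apply/translateP; apply: clA; exists (@harmonic R); split.
- by move=> n; exact: harmonic_gt0.
- move=> m n; rewrite -[harmonic n]/(n.+1%:R^-1) -[harmonic m]/(m.+1%:R^-1).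
  by rewrite lef_pV2 ?posrE ?ltr0n// ler_nat ltnS.
- exact: cvg_harmonic.
- move=> n; have [|u us Au] := h (t + harmonic n); first by rewrite ltrDl harmonic_gt0.
  rewrite -addrA -opprD -scalerDl; exact: param_up (ltW us) Au.
Qed.

(** If [u < t] is a parameter of [y], then [y - t *: k] differs from an element
    of [A] by a positive multiple of [- k], hence is in the core; conversely
    the core leaves room to decrease the parameter [t]. *)
Lemma phi_strict_sublevel t : core A (- k) ->
  [set y | nu_lt (phi_ A k y) (Some t%:E)] = translate (core A) (t *: k).
Proof.
move=> ck; apply/seteqP; split=> y.
  move=> /phi_ltP[u ut Au]; apply/translateP.
  have -> : y - t *: k = (t - u) *: (- k) + (y - u *: k).
    by rewrite scalerN scalerBl opprB [RHS]addrC addrA subrK.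
  by apply: coreD => //; apply: coreZ => //; rewrite subr_gt0.
move=> /translateP /(core_dir k)[e e0 Ae]; apply/phi_ltP.
exists (t - e); first by rewrite ltrBlDr ltrDl.
by rewrite scalerBl opprB addrA addrAC.
Qed.

(** [- k] in the core of [A] absorbs both [y], which provides a parameter of
    [y], and [- y], which bounds the parameters from below. *)
Lemma core_finite : core A (- k) -> finite_valued (phi_ A k) [set: Y].
Proof.
move=> ck y _.
have [e e0 Ae] := core_dir y ck.
have [d d0 Ad] := core_dir (- y) ck.
apply: (@phi_bounded_real _ _ A k y e^-1 (- d^-1)).
  apply: (cone_inv _ e0); first by case: hA.
  by rewrite scalerBr scalerA mulfV ?gt_eqF// scale1r addrC.
(* For a parameter u < - d^-1, the sum of d *: (y - u *: k) and - k - d *: y is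
   a positive multiple of k. *)
move=> u Au; rewrite leNgt; apply/negP => ud; apply: (core_opp hA ck).
have du : 0 < - (d * u) - 1.
  by rewrite subr_gt0 ltrNr -(ltr_pdivlMl _ _ d0) mulrN1.
apply: (cone_inv _ du); first by case: hA.
have := coneD hA (coneZ hA (ltW d0) Au) Ad.
rewrite scalerBr scalerA scalerN [- k - _]addrC addrACA subrr add0r.
by rewrite scalerBl scaleNr scale1r.
Qed.

Lemma finite_direction : finite_valued (phi_ A k) [set: Y] -> ~ A k.
Proof.
move=> fin Ak; have [r hr] := fin 0 I.
have : nu_dom (phi_ A k) 0 by exists r%:E.
by move/(phi_cone_Ny Ak); rewrite hr.
Qed.

(** For [u > 0] with [v - u *: k] in [A], the segment from [- k] to
    [- k + u^-1 *: v] is in [A], as both ends are. *)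
Lemma finite_core : nu_dom (phi_ A k) = [set: Y] -> A (- k) -> core A (- k).
Proof.
move=> domT ANk; split=> // v.
have : [set: Y] v by []; rewrite -domT => /phi_domP[t At].
pose u := Num.max t 1.
have u0 : 0 < u by rewrite lt_max ltr01 orbT.
have Au : A (v - u *: k) by apply: param_up At => //; rewrite le_max lexx.
exists u^-1 => [|s /andP[s0 su]]; first by rewrite invr_gt0.
have -> : - k + s *: v = (1 - s * u) *: (- k) + s *: (v - u *: k).
  rewrite scalerBr scalerA scalerN scalerBl scale1r opprB.
  by rewrite [RHS]addrC addrA subrK addrC.
apply: coneD => //; apply: coneZ => //.
by rewrite subr_ge0 -ler_pdivlMr// mul1r.
Qed.

(** The line of [k] meets [A] only in 0, so a parameter of [- a] with [a] in
    [A] has to be 0: [A] is symmetric, and [k] spans a complement. *)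
Lemma finite_hyperplane : nu_dom (phi_ A k) = [set: Y] -> ~ A k -> ~ A (- k) ->
  linear_subspace A /\ has_codim A 1.
Proof.
move=> domT Ak ANk.
have coord y : exists t, A (y - t *: k) by apply/phi_domP; rewrite domT.
have line0 t : A (t *: k) -> t = 0.
  move=> At; apply: contrapT => /eqP; rewrite neq_lt => /orP[t0|t0].
  - apply: ANk; apply: (@cone_inv _ _ _ _ (- t)); first by case: hA.
      by rewrite oppr_gt0.
    by rewrite scaleNr scalerN opprK.
  - by apply: Ak; apply: (cone_inv _ t0) => //; case: hA.
have AN a : A a -> A (- a).
  move=> Aa; have [t At] := coord (- a).
  have t0 : - t = 0.
    by apply: line0; have := coneD hA Aa At; rewrite addrA subrr add0r scaleNr.
  by move: At; rewrite -[t]opprK t0 oppr0 scale0r subr0.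
split.
  split=> [|l a b]; rewrite !inE; first exact: cone0.
  move=> Aa Ab; apply: coneD => //.
  have [l0|/ltW l0] := leP 0 l; first exact: coneZ.
  rewrite -[l *: a]opprK -scaleNr; apply: AN; apply: coneZ => //.
  by rewrite oppr_ge0.
exists (fun=> k); split=> [c|y].
  by rewrite big_ord1 => /line0 c0 i; rewrite ord1.
have [t At] := coord y.
by exists (fun=> t); rewrite big_ord1.
Qed.

(** As [k] is nonzero in the one-dimensional quotient by [A], it spans it: each
    [y] has exactly one parameter, its coordinate along [k]. *)
Lemma hyperplane_linear : linear_subspace A -> has_codim A 1 -> ~ A k ->
  is_linear_function (phi_ A k).
Proof.
move=> [_ linA] [e [_ cod]] Ak.
have ALC l a b : A a -> A b -> A (l *: a + b).
  by move=> Aa Ab; have := linA l a b; rewrite !inE; exact.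
have AB a b : A a -> A b -> A (a - b).
  by move=> Aa Ab; rewrite addrC -scaleN1r; exact: ALC.
have uniq y s t : A (y - s *: k) -> A (y - t *: k) -> s = t.
  move=> As At; apply: contrapT => /eqP st; apply: Ak.
  have := AB _ _ At As; rewrite opprB addrC addrA subrK -scalerBl => Ast.
  have := ALC (s - t)^-1 _ _ Ast (cone0 hA).
  by rewrite addr0 scalerA mulVf ?scale1r// subr_eq0.
have coord y : exists t, A (y - t *: k).
  have [c] := cod k; rewrite big_ord1; set c0 := c ord0 => Ac.
  have [d] := cod y; rewrite big_ord1; set d0 := d ord0 => Ad.
  have c0_neq0 : c0 != 0.
    by apply/eqP => c00; apply: Ak; rewrite c00 scale0r subr0 in Ac.
  exists (d0 / c0).
  have := ALC (- (d0 / c0)) _ _ Ac Ad.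
  rewrite scalerBr scalerA mulNr divfK// !scaleNr opprK.
  by rewrite addrC [_ + d0 *: _]addrC addrA subrK.
have [f Af] := choice coord.
have f_lin : linear_for *%R f.
  move=> l x y; apply: (uniq (l *: x + y)) => //.
  rewrite scalerDl opprD addrACA -scalerA -scalerBr; exact: ALC.
pose F : {scalar Y} := HB.pack f (GRing.isLinear.Build R Y R *%R f f_lin).
exists F => y; rewrite -[F y]/(f y).
have [r hr] : exists r, phi_ A k y = Some r%:E.
  by apply: (phi_bounded_real (Af y) (m := f y)) => u /uniq-/(_ _ (Af y)) ->.
have : nu_le (phi_ A k y) (Some (f y)%:E) by exact: phi_le.
have : ~ nu_lt (phi_ A k y) (Some (f y)%:E).
  by move/phi_ltP => [u uf /uniq-/(_ _ (Af y)) E]; rewrite E ltxx in uf.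
rewrite hr => nlt le_rf.
have {}le_rf : r <= f y by rewrite -lee_fin.
have le_fr : f y <= r by rewrite leNgt; apply/negP.
by congr (Some _%:E); apply/eqP; rewrite eq_le le_rf.
Qed.

Lemma finite_dichotomy : finite_valued (phi_ A k) [set: Y] <->
  core A (- k) \/ (linear_subspace A /\ has_codim A 1 /\ ~ A k).
Proof.
split=> [fin|[|[subA [codA Ak]]]]; last 2 first.
- exact: core_finite.
- have [f hf] := hyperplane_linear subA codA Ak.
  by move=> y _; exists (f y).
have Ak := finite_direction fin.
have domT : nu_dom (phi_ A k) = [set: Y].
  by apply/seteqP; split=> // y _; have [r hr] := fin y I; exists r%:E.
have [ANk|ANk] := pselect (A (- k)); first by left; exact: finite_core.
by right; have [? ?] := finite_hyperplane domT Ak ANk.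
Qed.

End cone_functional.

Theorem proposition9 (R : realType) (Y : lmodType R) (k : Y) (A : set Y)
    (hk : k != 0) (hA : nontrivial_convex_cone A) :
  (* (a) *)
  convex_set (M := Y) (nu_dom (phi_ A k)) /\
  (* (b) *)
  (sublinear (phi_ A k) /\
   monotone_dom (phi_ A k) (oppset A) /\
   (forall F : set Y, finite_valued (phi_ A k) F ->
      strictly_monotone_on (phi_ A k) (oppset (core A)) F)) /\
  (* (c) *)
  ((A k -> forall y, nu_dom (phi_ A k) y -> phi_ A k y = Some -oo%E) /\
   ((oppset A `&` A) k -> nu_dom (phi_ A k) = A)) /\
  (* (d) *)
  (oppset A k ->
     nu_dom (phi_ A k) =
       [set a + b | a in A & b in [set t *: k | t in [set t : R | 0 < t]]] /\
     (directionally_closed A k -> forall t : R,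
        [set y | nu_le (phi_ A k y) (Some t%:E)] = translate A (t *: k))) /\
  (* (e) *)
  ((finite_valued (phi_ A k) [set: Y] <->
      oppset (core A) k \/
      (linear_subspace A /\ has_codim A 1 /\ ~ A k)) /\
   (oppset (core A) k -> forall t : R,
      [set y | nu_lt (phi_ A k y) (Some t%:E)] =
        translate (core A) (t *: k)) /\
   (linear_subspace A /\ has_codim A 1 /\ ~ A k ->
      is_linear_function (phi_ A k))).
Proof.
split; first exact: phi_dom_convex.
split.
  split; first exact: phi_sublinear.
  by split; [exact: phi_monotone|move=> F; exact: phi_strictly_monotone].
split.
  split=> [Ak y|[/oppsetP ANk Ak]]; first exact: phi_cone_Ny.
  exact: phi_dom_lineality.
split.
  move=> /oppsetP ANk; split; first exact: phi_dom_upward.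
  by move=> clA t; exact: phi_sublevel_upward.
split.
  split=> [/(finite_dichotomy k hA)[ck|]|[/oppsetP ck|hyp]].
  - by left; apply/oppsetP.
  - by right.
  - by apply/finite_dichotomy => //; left.
  - by apply/finite_dichotomy => //; right.
split=> [/oppsetP ck t|[subA [codA Ak]]]; first exact: phi_strict_sublevel.
exact: hyperplane_linear.
Qed.
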